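(* Let $V$ be an optimal prefix-free machine, and for real $T>0$ let $\Theta_V(T)=\sum_{s\in\{0,1\}^*,\,H_V(s)<|s|}2^{-|s|/T}$. For every $T\in(0,1)$, if $\Theta_V(T)$ is right-computable, then $T$ is also right-computable.
   Context: $\{0,1\}^*$ is the set of finite binary strings; $|s|$ is the length of $s$. A prefix-free machine is a partial recursive function $C:\{0,1\}^*\to\{0,1\}^*$ whose domain is prefix-free. $H_C(s)=\min\{|p| : C(p)=s\}$ (possibly $\infty$). A prefix-free machine $V$ is optimal if for every prefix-free machine $C$ there is $d\in\mathbb{N}$ such that for every $p\in\mathrm{Dom}\,C$ there is $q\in\mathrm{Dom}\,V$ with $V(q)=C(p)$ and $|q|\le|p|+d$. A real $\alpha$ is right-computable if there is a total recursive $f:\mathbb{N}^+\to\mathbb{Q}$ with $\alpha\le f(n)$ for all $n$ and $\lim_n f(n)=\alpha$. *)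

(* Defs.v *)
From HB Require Import structures.
From mathcomp Require Import all_boot all_order all_algebra.
From mathcomp Require Import all_classical all_reals all_analysis.
Set Implicit Arguments. Unset Strict Implicit. Unset Printing Implicit Defensive.
Import Order.TTheory GRing.Theory Num.Theory.
Import numFieldNormedType.Exports.
Local Open Scope ring_scope.
Local Open Scope classical_set_scope.

(* Argument lists are seq nat; missing arguments read as 0 (nth 0). *)
Inductive rf : Type :=
| rZero : rf
| rSucc : rf
| rProj : nat -> rf
| rComp : rf -> seq rf -> rf
| rPrim : rf -> rf -> rf
| rMu   : rf -> rf.

Inductive rf_eval : rf -> seq nat -> nat -> Prop :=
| ev_zero v : rf_eval rZero v 0
| ev_succ v : rf_eval rSucc v (nth 0 v 0).+1
| ev_proj i v : rf_eval (rProj i) v (nth 0 v i)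
| ev_comp f gs v ys y :
    rf_evals gs v ys -> rf_eval f ys y -> rf_eval (rComp f gs) v y
| ev_prim0 f g v y : rf_eval f v y -> rf_eval (rPrim f g) (0 :: v) y
| ev_primS f g n v r y :
    rf_eval (rPrim f g) (n :: v) r -> rf_eval g (n :: r :: v) y ->
    rf_eval (rPrim f g) (n.+1 :: v) y
| ev_mu f v n :
    rf_eval f (n :: v) 0 ->
    (forall m, (m < n)%N -> exists k, rf_eval f (m :: v) k.+1) ->
    rf_eval (rMu f) v n
with rf_evals : seq rf -> seq nat -> seq nat -> Prop :=
| evs_nil v : rf_evals [::] v [::]
| evs_cons g gs v y ys :
    rf_eval g v y -> rf_evals gs v ys -> rf_evals (g :: gs) v (y :: ys).

Definition total_recursive (f : nat -> nat) : Prop :=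
  exists e : rf, forall n y, rf_eval e [:: n] y <-> y = f n.

(* Bijective coding of binary strings by naturals:
   [::] |-> 0, b :: s |-> 2 * code s + 1 + b. *)
Fixpoint bcode (s : seq bool) : nat :=
  match s with
  | [::] => 0
  | b :: s' => (bcode s').*2 + 1 + b
  end.

Definition partial_recursive (C : seq bool -> option (seq bool)) : Prop :=
  exists e : rf, forall p s, C p = Some s <-> rf_eval e [:: bcode p] (bcode s).

Definition dom (C : seq bool -> option (seq bool)) (p : seq bool) : Prop :=
  C p <> None.

Definition prefix_free_set (D : seq bool -> Prop) : Prop :=
  forall p q, D p -> D q -> prefix p q -> p = q.

Definition prefix_free_machine (C : seq bool -> option (seq bool)) : Prop :=
  partial_recursive C /\ prefix_free_set (dom C).

(* H_C(s) = min { |p| : C(p) = s }, +oo if no such p. *)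
Definition Hc {R : realType} (C : seq bool -> option (seq bool)) (s : seq bool)
  : \bar R :=
  ereal_inf [set ((size p)%:R)%:E | p in [set p | C p = Some s]].

Definition optimal (V : seq bool -> option (seq bool)) : Prop :=
  prefix_free_machine V /\
  forall C, prefix_free_machine C ->
    exists d : nat, forall p s, C p = Some s ->
      exists q, V q = Some s /\ (size q <= size p + d)%N.

(* A total recursive f : N+ -> Q, coded as f n = (a n - b n) / (c n + 1)
   with a, b, c total recursive nat -> nat. *)
Definition total_recursive_rat (f : nat -> rat) : Prop :=
  exists a b c : nat -> nat,
    [/\ total_recursive a, total_recursive b, total_recursive c &
        forall n, (0 < n)%N ->
          f n = ((a n)%:Q - (b n)%:Q) / ((c n).+1)%:Q].

Definition right_computable {R : realType} (alpha : R) : Prop :=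
  exists f : nat -> rat,
    [/\ total_recursive_rat f,
        (forall n, (0 < n)%N -> alpha <= ratr (f n)) &
        (fun n => ratr (f n) : R) @ \oo --> alpha].

Definition Theta {R : realType} (V : seq bool -> option (seq bool)) (T : R)
  : \bar R :=
  \esum_(s in [set s | (@Hc R V s < ((size s)%:R)%:E)%E])
     (powR 2 (- (size s)%:R / T))%:E.

(* Main.v *)
(** For fixed [l > 0] the term [2^(- l / x)] is strictly increasing in [x], and
    the compressible strings are recursively enumerable and exist.  So if the
    rationals [f t] converge to [Theta V T] from above, then a rational [r]
    exceeds [T] exactly when, for some stage [t], the sum of [2^(- |s| / r)] over
    the strings [s] seen to be compressible by stage [t] exceeds [f t]; and for
    a given [r > T] this happens at all large stages.  At stage [t] the test is
    applied to the multiples of [1 / t], and the number of failures gives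
    an upper approximation to [T]. *)
Require Import Defs.
From HB Require Import structures.
From mathcomp Require Import all_boot all_order all_algebra.
From mathcomp Require Import all_classical all_reals all_analysis.
From mathcomp Require Import zify ring lra.
Import Order.TTheory GRing.Theory Num.Theory.
Import numFieldNormedType.Exports.

(** * Evaluation of recursive functions within a search bound *)

(** [rComp] nests [rf] inside a list, so the hypotheses on its arguments are gathered in an iterated
    conjunction, built by an inner fixpoint over that list. *)
Fixpoint rf_nested_ind (P : rf -> Prop) (hZ : P rZero) (hS : P rSucc)
    (hp : forall i, P (rProj i))
    (hc : forall f gs, P f -> foldr (fun g => and (P g)) True gs ->
      P (rComp f gs))
    (hr : forall f g, P f -> P g -> P (rPrim f g))
    (hm : forall f, P f -> P (rMu f)) (e : rf) : P e :=
  let IH := rf_nested_ind P hZ hS hp hc hr hm in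
  match e with
  | rZero => hZ
  | rSucc => hS
  | rProj i => hp i
  | rComp f gs => hc f gs (IH f)
      ((fix IHs gs : foldr (fun g => and (P g)) True gs :=
          match gs with
          | [::] => I
          | g :: gs' => conj (IH g) (IHs gs')
          end) gs)
  | rPrim f g => hr f g (IH f) (IH g)
  | rMu f => hm f (IH f)
  end.

(* The value is shifted by one; [0] means that no value is found within the
   search bound [t]. *)
Fixpoint stepf (e : rf) (t : nat) (v : seq nat) : nat :=
  match e with
  | rZero => 1
  | rSucc => (nth 0 v 0).+2
  | rProj i => (nth 0 v i).+1
  | rComp f gs =>
      let ys := [seq stepf g t v | g <- gs] in
      if has (pred1 0) ys then 0 else stepf f t [seq y.-1 | y <- ys]
  | rPrim f g =>
      if v is n :: u then
        nat_rect (fun=> nat) (stepf f t u)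
          (fun m r => if r == 0 then 0 else stepf g t [:: m, r.-1 & u]) n
      else 0
  | rMu f =>
      let n := find (fun n => stepf f t (n :: v) <= 1) (iota 0 t) in
      if stepf f t (n :: v) == 1 then n.+1 else 0
  end.

(** The case [n = t] is included because [find] returns the length of the list when nothing is
    found, and the [rMu] clause of [stepf] still tests that value. *)
Lemma find_iotaE (p : pred nat) (n t : nat) :
  n <= t -> (forall m, m < n -> ~~ p m) -> (n < t -> p n) ->
  find p (iota 0 t) = n.
Proof.
move=> nt np pn; rewrite -(subnKC nt) iotaD find_cat size_iota add0n.
have -> : has p (iota 0 n) = false.
  by apply/hasPn => m; rewrite mem_iota => /andP[_]; apply: np.
have [->|tn] := posnP (t - n); first by rewrite addn0.
by rewrite -(prednK tn) /= pn ?addn0// -subn_gt0.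
Qed.

Lemma ltn_find_iota (p : pred nat) (m t : nat) :
  m < find p (iota 0 t) -> ~~ p m.
Proof.
move=> mt; have mt' : m < t.
  by rewrite (leq_trans mt)// -[leqRHS](size_iota 0) find_size.
by have := before_find 0 mt; rewrite nth_iota// => ->.
Qed.

(** A larger bound can only turn a failure into a value. For [rMu], success means that all smaller
    arguments gave positive values; these persist by induction, so the longer search stops at the
    same place. *)
Lemma stepf_mono e t t' v y : t <= t' -> stepf e t v = y.+1 ->
  stepf e t' v = y.+1.
Proof.
move=> tt'; elim/rf_nested_ind: e v y => //=.
- move=> f gs IHf IHgs v y; case: ifP => // nz fy.
  have -> : [seq stepf g t' v | g <- gs] = [seq stepf g t v | g <- gs].
    elim: gs IHgs nz {fy} => //= g gs IH [IHg IHgs] /negbT.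
    rewrite negb_or => /andP[gz gsz]; rewrite IH//; last exact/negbTE.
    by case: (stepf g t v) (IHg v) gz => // r /(_ _ erefl) ->.
  by rewrite nz; apply: IHf.
- move=> f g IHf IHg [//|n u].
  elim: n => [|n IHn] y /=; first exact: IHf.
  case: (nat_rect _ _ _ n) IHn => [//|r] /(_ _ erefl) -> /=.
  exact: IHg.
- move=> f IHf v y; set n := find _ _; case: ifP => // /eqP fn [<-].
  have nt : n <= t by rewrite -[leqRHS](size_iota 0) find_size.
  rewrite (@find_iotaE _ n) ?(IHf _ _ fn)//; first exact: leq_trans tt'.
  move=> m /ltn_find_iota; rewrite -ltnNge.
  by case E: (stepf f t (m :: v)) => [//|r]; rewrite (IHf _ _ E) -ltnNge.
Qed.

Lemma stepf_sound e t v y : stepf e t v = y.+1 -> rf_eval e v y.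
Proof.
elim/rf_nested_ind: e v y => /=.
- by move=> v y [<-]; constructor.
- by move=> v y [<-]; constructor.
- by move=> i v y [<-]; constructor.
- move=> f gs IHf IHgs v y; case: ifP => // nz fy.
  apply: (ev_comp (ys := [seq y.-1 | y <- [seq stepf g t v | g <- gs]]));
    last exact: IHf.
  elim: gs IHgs nz {fy} => [|g gs IH] /=; first by constructor.
  move=> [IHg IHgs] /negbT; rewrite negb_or => /andP[gz /negbTE gsz].
  constructor; last exact: IH.
  by apply: IHg; case: (stepf g t v) gz.
- move=> f g IHf IHg [//|n u].
  elim: n => [|n IHn] y /=; first by move=> /IHf; constructor.
  case: (nat_rect _ _ _ n) IHn => [//|r] /(_ _ erefl) fr /= /IHg.
  exact: ev_primS.
- move=> f IHf v y; set n := find _ _; case: ifP => // /eqP fn [<-].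
  constructor; first exact: IHf.
  move=> m /ltn_find_iota; rewrite -ltnNge.
  by case E: (stepf f t (m :: v)) => [//|[//|k]] _; exists k; apply: IHf.
Qed.

(** Finitely many evaluations are involved at each node of [e]; by [stepf_mono] the maximum of their
    bounds serves for all. *)
Lemma stepf_complete e v y : rf_eval e v y -> exists t, stepf e t v = y.+1.
Proof.
elim/rf_nested_ind: e v y => /=.
- by move=> v y h; inversion h; exists 0.
- by move=> v y h; inversion h; exists 0.
- by move=> i v y h; inversion h; exists 0.
- move=> f gs IHf IHgs v y h.
  have [ys [hgs hf]] : exists ys, rf_evals gs v ys /\ rf_eval f ys y.
    by inversion h; eexists; split; eassumption.
  have [t1 ft1] := IHf _ _ hf.
  have [t2 gst2] : exists t, forall t', t <= t' ->
      [seq stepf g t' v | g <- gs] = map succn ys.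
    elim: gs IHgs ys hgs {h hf t1 ft1} => [|g gs IH] /=.
      by move=> _ ys hgs; inversion hgs; exists 0.
    move=> [IHg IHgs] ys hgs.
    have [z [zs [ysE hg hgs']]] : exists z zs,
        [/\ ys = z :: zs, rf_eval g v z & rf_evals gs v zs].
      by inversion hgs; do 2 eexists; split; first reflexivity.
    have [t1 gt1] := IHg _ _ hg; have [t2 gst2] := IH IHgs _ hgs'.
    exists (maxn t1 t2) => t'; rewrite ysE geq_max => /andP[t1t' /gst2 ->].
    by rewrite (stepf_mono _ _ _ _ _ t1t' gt1).
  exists (maxn t1 t2); rewrite gst2 ?leq_maxr//.
  have -> : has (pred1 0) (map succn ys) = false.
    by apply/hasPn => _ /mapP[z _ ->].
  by rewrite -map_comp map_id (stepf_mono _ _ _ _ _ _ ft1)// leq_maxl.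
- move=> f g IHf IHg v y h.
  have [n [u vE]] : exists n u, v = n :: u by inversion h; do 2 eexists.
  rewrite {v}vE in h *; elim: n y h => [|n IHn] y h.
    by apply: IHf; inversion h.
  have [r [hr hg]] : exists r,
      rf_eval (rPrim f g) (n :: u) r /\ rf_eval g [:: n, r & u] y.
    by inversion h; eexists; split; eassumption.
  have [t1 ft1] := IHn _ hr; have [t2 gt2] := IHg _ _ hg.
  exists (maxn t1 t2).
  have /= -> := stepf_mono (rPrim f g) _ _ (n :: u) _ (leq_maxl t1 t2) ft1.
  by rewrite (stepf_mono _ _ _ _ _ (leq_maxr t1 t2) gt2).
- move=> f IHf v n h.
  have [fn fm] : rf_eval f (n :: v) 0 /\
      forall m, m < n -> exists k, rf_eval f (m :: v) k.+1 by inversion h.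
  have [t1 ft1] := IHf _ _ fn.
  have [t2 ft2] : exists t, forall m, m < n -> 1 < stepf f t (m :: v).
    elim: n fm {h fn t1 ft1} => [|n IHn] fm; first by exists 0.
    have [t1 ft1'] := IHn (fun m mn => fm m (ltnW mn)).
    have [k fk] := fm n (leqnn _).
    have [t2 ft2] := IHf _ _ fk.
    exists (maxn t1 t2) => m; rewrite ltnS leq_eqVlt => /predU1P[->|mn].
      by rewrite (stepf_mono _ _ _ _ _ (leq_maxr t1 t2) ft2).
    have := ft1' m mn; case E: (stepf f t1 (m :: v)) => [//|r].
    by rewrite (stepf_mono _ _ _ _ _ (leq_maxl t1 t2) E).
  (* The bound must also reach [n], since the search of [rMu] runs over [iota 0 t]. *)
  pose t := maxn n (maxn t1 t2); exists t.
  have fn1 : stepf f t (n :: v) = 1.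
    by apply: stepf_mono ft1; rewrite leq_max leq_maxl orbT.
  rewrite (find_iotaE _ n) ?fn1 ?leq_maxl// => m mn.
  rewrite -ltnNge; have := ft2 m mn.
  case E: (stepf f t2 (m :: v)) => [//|r].
  by rewrite (stepf_mono _ _ t _ _ _ E)// /t !leq_max leqnn !orbT.
Qed.

(** Both values are already found at a common bound, where [stepf] has a single value. *)
Lemma rf_eval_inj e v y z : rf_eval e v y -> rf_eval e v z -> y = z.
Proof.
move=> /stepf_complete[t ty] /stepf_complete[u uz].
have := stepf_mono _ _ _ _ _ (leq_maxl t u) ty.
by rewrite (stepf_mono _ _ _ _ _ (leq_maxr t u) uz) => -[].
Qed.

(** * Closure properties of total recursive functions *)

(** One implication is enough because evaluation is deterministic ([rf_eval_inj]). Predicates are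
    covered through the coercion of [bool] to [nat]. *)
Definition recursive (k : nat) (F : seq nat -> nat) : Prop :=
  exists e, forall v, size v = k -> rf_eval e v (F v).

Definition recursives (k m : nat) (F : seq nat -> seq nat) : Prop :=
  exists es, forall v, size v = k -> rf_evals es v (F v) /\ size (F v) = m.

Lemma eq_recursive k F G : (forall v, size v = k -> F v = G v) ->
  recursive k F -> recursive k G.
Proof. by move=> FG [e eF]; exists e => v vk; rewrite -FG//; apply: eF. Qed.

Lemma recursives_nil k : recursives k 0 (fun=> [::]).
Proof. by exists [::] => v _; split => //; constructor. Qed.

Lemma recursives_cons k m F Fs : recursive k F -> recursives k m Fs ->
  recursives k m.+1 (fun v => F v :: Fs v).
Proof.
move=> [e eF] [es esFs]; exists (e :: es) => v vk.
have [? /= ->] := esFs v vk; split => //.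
by constructor => //; apply: eF.
Qed.

Lemma recursive_comp k m G F : recursive m G -> recursives k m F ->
  recursive k (fun v => G (F v)).
Proof.
move=> [e eG] [es esF]; exists (rComp e es) => v vk.
by have [? ?] := esF v vk; apply: ev_comp; first eassumption; apply: eG.
Qed.

Lemma recursives_drop k m : recursives (m + k) k (drop m).
Proof.
exists [seq rProj i | i <- iota m k] => v vk; split; last first.
  by rewrite size_drop vk addKn.
rewrite -[drop m v]take_size size_drop vk addKn -(map_nth_iota 0) ?vk ?addKn//.
by elim: (iota m k) => [|i s IH]; constructor => //; constructor.
Qed.

Lemma recursives_id k : recursives k k id.
Proof.
have [es h] := recursives_drop k 0; exists es => v /h.
by rewrite drop0.
Qed.

Lemma recursives_behead k : recursives k.+1 k behead.
Proof. by have [es h] := recursives_drop k 1; exists es => v /h; rewrite drop1. Qed.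

Lemma recursives_behead2 k : recursives k.+2 k (fun w => behead (behead w)).
Proof.
have [es h] := recursives_drop k 2; exists es => -[|x [|y v]] // /h.
by rewrite /= drop0.
Qed.

Lemma recursive_weaken k F : recursive k F ->
  recursive k.+1 (fun w => F (behead w)).
Proof. by move=> /recursive_comp; apply; apply: recursives_behead. Qed.

Lemma recursive_weaken2 k F : recursive k F ->
  recursive k.+2 (fun w => F (behead (behead w))).
Proof. by move=> rF; exact: (recursive_weaken _ _ (recursive_weaken _ _ rF)). Qed.

Lemma recursive_nth k i : recursive k (fun v => nth 0 v i).
Proof. by exists (rProj i) => v _; constructor. Qed.

Lemma recursive_head k : recursive k (head 0).
Proof. by apply: eq_recursive (recursive_nth k 0) => v _; rewrite nth0. Qed.

Lemma recursive_succ k F : recursive k F -> recursive k (fun v => (F v).+1).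
Proof.
move=> rF; have rS : recursive 1 (fun v => (nth 0 v 0).+1).
  by exists rSucc => v _; constructor.
exact: (recursive_comp _ _ _ _ rS
  (recursives_cons _ _ _ _ rF (recursives_nil k))).
Qed.

Lemma recursive_const k c : recursive k (fun=> c).
Proof.
elim: c => [|c]; last exact: recursive_succ.
by exists rZero => v _; constructor.
Qed.

(** The list handed to the step holds the counter, the previous value and then the parameters, as in
    [ev_primS]. *)
Lemma recursive_nat_rect k N B (S : seq nat -> nat -> nat -> nat) :
  recursive k N -> recursive k B ->
  recursive k.+2 (fun w =>
    S (behead (behead w)) (head 0 w) (head 0 (behead w))) ->
  recursive k (fun v => nat_rect (fun=> nat) (B v) (S v) (N v)).
Proof.
move=> rN [b eB] [s eS].
have rP : recursive k.+1 (fun w =>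
    nat_rect (fun=> nat) (B (behead w)) (S (behead w)) (head 0 w)).
  exists (rPrim b s) => -[//|n v] /= [vk].
  elim: n => [|n IH] /=; first by constructor; apply: eB.
  by apply: ev_primS; [exact: IH|apply: (eS [:: n, _ & v]); rewrite /= vk].
exact: (recursive_comp _ _ _ _ rP
  (recursives_cons _ _ _ _ rN (recursives_id k))).
Qed.

(** For the part of a recursion step that uses the counter but not the previous value. *)
Lemma recursive_weaken1 k (F : seq nat -> nat -> nat) :
  recursive k.+1 (fun w => F (behead w) (head 0 w)) ->
  recursive k.+2 (fun w => F (behead (behead w)) (head 0 w)).
Proof.
move=> /recursive_comp; move/(_ k.+2 (fun w => head 0 w :: behead (behead w))).
by apply; apply: recursives_cons (recursive_head _) (recursives_behead2 k).
Qed.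

Lemma recursive_pred k F : recursive k F -> recursive k (fun v => (F v).-1).
Proof.
move=> rF; apply: (eq_recursive k (fun v =>
  nat_rect (fun=> nat) 0 (fun n _ => n) (F v))); first by move=> v _; case: (F v).
apply: recursive_nat_rect => //; first exact: recursive_const.
exact: recursive_head.
Qed.

Lemma recursive_add k F G : recursive k F -> recursive k G ->
  recursive k (fun v => F v + G v).
Proof.
move=> rF rG; apply: (eq_recursive k (fun v =>
  nat_rect (fun=> nat) (F v) (fun _ r => r.+1) (G v))).
  by move=> v _; elim: (G v) => [|n /= ->]; rewrite ?addn0 ?addnS.
apply: recursive_nat_rect => //; apply: recursive_succ.
exact/recursive_weaken/recursive_head.
Qed.

Lemma recursive_sub k F G : recursive k F -> recursive k G ->
  recursive k (fun v => F v - G v).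
Proof.
move=> rF rG; apply: (eq_recursive k (fun v =>
  nat_rect (fun=> nat) (F v) (fun _ r => r.-1) (G v))).
  by move=> v _; elim: (G v) => [|n /= ->]; rewrite ?subn0 ?subnS.
apply: recursive_nat_rect => //; apply: recursive_pred.
exact/recursive_weaken/recursive_head.
Qed.

Lemma recursive_sum k N (F : seq nat -> nat -> nat) : recursive k N ->
  recursive k.+1 (fun w => F (behead w) (head 0 w)) ->
  recursive k (fun v => \sum_(0 <= i < N v) F v i).
Proof.
move=> rN rF; apply: (eq_recursive k (fun v =>
  nat_rect (fun=> nat) 0 (fun n r => r + F v n) (N v))).
  move=> v _; elim: (N v) => [|n /= ->]; first by rewrite big_geq.
  by rewrite big_nat_recr.
apply: recursive_nat_rect => //; first exact: recursive_const.
apply: recursive_add; first exact/recursive_weaken/recursive_head.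
exact: recursive_weaken1.
Qed.

Lemma recursive_mul k F G : recursive k F -> recursive k G ->
  recursive k (fun v => F v * G v).
Proof.
move=> rF rG; apply: (eq_recursive k (fun v => \sum_(0 <= i < G v) F v)).
  by move=> v _; rewrite sum_nat_const_nat subn0 mulnC.
by apply: recursive_sum => //; apply: recursive_weaken.
Qed.

Lemma recursive_exp k F G : recursive k F -> recursive k G ->
  recursive k (fun v => F v ^ G v).
Proof.
move=> rF rG; apply: (eq_recursive k (fun v =>
  nat_rect (fun=> nat) 1 (fun _ r => F v * r) (G v))).
  by move=> v _; elim: (G v) => [|n /= ->]; rewrite ?expnS.
apply: recursive_nat_rect => //; first exact: recursive_const.
apply: recursive_mul; first exact: recursive_weaken2.
exact/recursive_weaken/recursive_head.
Qed.

Lemma recursive_leq k F G : recursive k F -> recursive k G ->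
  recursive k (fun v => F v <= G v).
Proof.
move=> rF rG; apply: (eq_recursive k (fun v => 1 - (F v - G v))).
  by move=> v _; rewrite -subn_eq0; case: (F v - G v).
apply: recursive_sub; first exact: recursive_const.
exact: recursive_sub.
Qed.

Lemma recursive_negb k (b : seq nat -> bool) : recursive k b ->
  recursive k (fun v => ~~ b v).
Proof.
move=> rb; apply: (eq_recursive k (fun v => 1 - b v)).
  by move=> v _; case: (b v).
by apply: recursive_sub => //; apply: recursive_const.
Qed.

Lemma recursive_andb k (b c : seq nat -> bool) : recursive k b ->
  recursive k c -> recursive k (fun v => b v && c v).
Proof.
move=> rb rc; apply: (eq_recursive k (fun v => b v * c v)).
  by move=> v _; rewrite mulnb.
exact: recursive_mul.
Qed.

Lemma recursive_eqn k F G : recursive k F -> recursive k G ->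
  recursive k (fun v => F v == G v).
Proof.
move=> rF rG; apply: (eq_recursive k (fun v => (F v <= G v) && (G v <= F v))).
  by move=> v _; rewrite eqn_leq.
by apply: recursive_andb; apply: recursive_leq.
Qed.

Lemma recursive_if k (b : seq nat -> bool) F G : recursive k b ->
  recursive k F -> recursive k G ->
  recursive k (fun v => if b v then F v else G v).
Proof.
move=> rb rF rG; apply: (eq_recursive k (fun v => b v * F v + ~~ b v * G v)).
  by move=> v _; case: (b v); rewrite ?mul1n ?addn0 ?mul0n ?add0n.
apply: recursive_add; apply: recursive_mul => //.
exact: recursive_negb.
Qed.

(** The first index satisfying [p] equals the number of [i] such that no [j <= i] satisfies [p],
    which reduces bounded search to sums. *)
Lemma recursive_find_iota k N (p : seq nat -> pred nat) : recursive k N ->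
  recursive k.+1 (fun w => p (behead w) (head 0 w)) ->
  recursive k (fun v => find (p v) (iota 0 (N v))).
Proof.
move=> rN rp.
apply: (eq_recursive k (fun v =>
  \sum_(0 <= i < N v) (\sum_(0 <= j < i.+1) p v j == 0))).
  move=> v _; elim: (N v) => [|n IH]; first by rewrite big_geq.
  rewrite big_nat_recr// {}IH -[in RHS](addn1 n) iotaD find_cat add0n size_iota /=.
  have -> : (\sum_(0 <= j < n.+1) p v j == 0) =
      ~~ has (p v) (iota 0 n) && ~~ p v n.
    rewrite big_mkord sum_nat_eq0; apply/forallP/andP => [h|[/hasPn h pn] i].
      split; last by have := h ord_max; rewrite eqb0.
      apply/hasPn => i; rewrite mem_iota => /andP[_ ltin].
      by have := h (Ordinal (ltnW ltin : i < n.+1)); rewrite eqb0.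
    rewrite eqb0 implyTb; have := ltn_ord i.
    rewrite ltnS leq_eqVlt => /predU1P[->//|ltin].
    by apply: h; rewrite mem_iota.
  case: ifP => h; first by rewrite addn0.
  rewrite hasNfind ?h// size_iota.
  by case: (p v n).
apply: recursive_sum => //; apply: recursive_eqn; last exact: recursive_const.
apply: recursive_sum; first exact/recursive_succ/recursive_head.
exact: (recursive_weaken1 _ p).
Qed.

Lemma recursive_has_iota k N (p : seq nat -> pred nat) : recursive k N ->
  recursive k.+1 (fun w => p (behead w) (head 0 w)) ->
  recursive k (fun v => has (p v) (iota 0 (N v))).
Proof.
move=> rN rp.
apply: (eq_recursive k (fun v => find (p v) (iota 0 (N v)) < N v)).
  by move=> v _; rewrite has_find size_iota.
by apply: recursive_leq => //; apply/recursive_succ/recursive_find_iota.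
Qed.

Ltac recursion := repeat lazymatch goal with
  | H : recursive ?k ?F |- recursive ?k ?F => exact H
  | |- recursive _ (fun _ => ?c) => apply: recursive_const
  | |- recursive _ (head 0) => exact: recursive_head
  | |- recursive ?k (fun w => head 0 w) => exact: recursive_head
  | |- recursive ?k (fun v => S (@?F v)) => apply: (recursive_succ k F)
  | |- recursive ?k (fun v => predn (@?F v)) => apply: (recursive_pred k F)
  | |- recursive ?k (fun v => addn (@?F v) (@?G v)) =>
      apply: (recursive_add k F G)
  | |- recursive ?k (fun v => subn (@?F v) (@?G v)) =>
      apply: (recursive_sub k F G)
  | |- recursive ?k (fun v => muln (@?F v) (@?G v)) =>
      apply: (recursive_mul k F G)
  | |- recursive ?k (fun v => expn (@?F v) (@?G v)) =>
      apply: (recursive_exp k F G)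
  | |- recursive ?k (fun v => nat_of_bool (leq (@?F v) (@?G v))) =>
      apply: (recursive_leq k F G)
  | |- recursive ?k (fun v => nat_of_bool (@?F v == @?G v)) =>
      apply: (recursive_eqn k F G)
  | |- recursive ?k (fun v => nat_of_bool (@?F v && @?G v)) =>
      apply: (recursive_andb k F G)
  | |- recursive ?k (fun v => nat_of_bool (~~ (@?F v))) =>
      apply: (recursive_negb k F)
  | |- recursive ?k (fun v => \sum_(0 <= i < @?N v) (@?F v i)) =>
      apply: (recursive_sum k N F)
  | |- recursive ?k (fun v => find (@?p v) (iota 0 (@?N v))) =>
      apply: (recursive_find_iota k N p)
  | |- recursive ?k (fun v => nat_of_bool (has (@?p v) (iota 0 (@?N v)))) =>
      apply: (recursive_has_iota k N p)
  | |- recursive ?k (fun v => match @?b v with true => _ | false => _ end) =>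
      apply: (recursive_if k b)
  | |- recursive _.+1 (fun w => _) =>
      first [apply: recursive_weaken | apply: recursive_weaken2]
  end.

(** The program is fixed, so the induction is on [e]. The arity [k] stays general because
    subprograms are run on lists of other lengths. *)
Lemma recursive_stepf e k :
  recursive k.+1 (fun w => stepf e (head 0 w) (behead w)).
Proof.
have rs_comp f m l T Fs :
    recursive m.+1 (fun w => stepf f (head 0 w) (behead w)) ->
    recursive l T -> recursives l m Fs ->
    recursive l (fun v => stepf f (T v) (Fs v)).
  move=> rf rT rFs.
  exact: (recursive_comp _ _ _ _ rf (recursives_cons _ _ _ _ rT rFs)).
elim/rf_nested_ind: e k => /=; try by move=> *; recursion.
- move=> k; recursion; apply: (recursive_weaken _ (fun v => nth 0 v 0)).
  exact: recursive_nth.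
- move=> i k; recursion; apply: (recursive_weaken _ (fun v => nth 0 v i)).
  exact: recursive_nth.
- move=> f gs IHf IHgs k.
  apply: (recursive_if _
    (fun w => has (pred1 0) [seq stepf g (head 0 w) (behead w) | g <- gs])
    (fun=> 0)); first 2 last.
  + apply: rs_comp (IHf (size gs)) (recursive_head _) _.
    elim: gs IHgs {IHf} => [_|g gs IH [IHg IHgs]]; first exact: recursives_nil.
    by apply: recursives_cons; [exact/recursive_pred|exact: IH].
  + elim: gs IHgs {IHf} => [_|g gs IH [/(_ k) IHg IHgs]] /=; first by recursion.
    (* The disjunction in [has] is rewritten by De Morgan with the connectives treated above. *)
    apply: (eq_recursive _ (fun w =>
      ~~ (~~ (stepf g (head 0 w) (behead w) == 0) &&
        ~~ has (pred1 0) [seq stepf g (head 0 w) (behead w) | g <- gs]))).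
      by move=> w _; rewrite negb_and !negbK.
    by recursion; exact: IH.
  + by recursion.
- move=> f g IHf IHg [|k].
    (* Here the argument list is empty, and [stepf] of [rPrim] is then 0. *)
    apply: (eq_recursive _ (fun=> 0)); last by recursion.
    by move=> [|t []].
  apply: (eq_recursive _ (fun w => nat_rect (fun=> nat)
    (stepf f (head 0 w) (behead (behead w)))
    (fun m r => if r == 0 then 0
                else stepf g (head 0 w) [:: m, r.-1 & behead (behead w)])
    (head 0 (behead w)))); first by move=> [|t []].
  apply: (recursive_nat_rect _ _
    (fun w => stepf f (head 0 w) (behead (behead w)))
    (fun w m r => if r == 0 then 0
                else stepf g (head 0 w) [:: m, r.-1 & behead (behead w)])).
  + by recursion.
  + exact: rs_comp (IHf k) (recursive_head _) (recursives_behead2 k).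
  + recursion.
    apply: rs_comp (IHg k.+2) (recursive_weaken2 _ _ (recursive_head _)) _.
    apply: recursives_cons; first by recursion.
    apply: recursives_cons; first by recursion.
    (* The four entries dropped are the counter, the previous value, the bound and the recursion
       argument. *)
    have [es h] := recursives_drop k 4; exists es => -[|? [|? [|? [|? v]]]] // /h.
    by rewrite /= drop0.
- move=> f IHf k.
  have rfind : recursive k.+1 (fun w =>
      find (fun n => stepf f (head 0 w) (n :: behead w) <= 1)
        (iota 0 (head 0 w))).
    recursion.
    apply: rs_comp (IHf k.+1) (recursive_weaken _ _ (recursive_head _)) _.
    exact: recursives_cons (recursive_head _) (recursives_behead2 k).
  recursion.
  apply: rs_comp (IHf k.+1) (recursive_head _) _.
  by apply: recursives_cons; [exact: rfind|exact: recursives_behead].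
Qed.

Lemma recursive_total_recursive f k F : total_recursive f ->
  recursive k F -> recursive k (fun v => f (F v)).
Proof.
move=> [e ef] rF.
have rf1 : recursive 1 (fun v => f (head 0 v)).
  by exists e => -[//|n [|]] // _; apply/ef.
exact: (recursive_comp _ _ _ _ rf1
  (recursives_cons _ _ _ _ rF (recursives_nil k))).
Qed.

Lemma total_recursive_recursive f :
  recursive 1 (fun v => f (head 0 v)) -> total_recursive f.
Proof.
move=> [e ef]; exists e => n y; have efn : rf_eval e [:: n] (f n) by exact: ef.
by split=> [/rf_eval_inj/(_ efn)//|->].
Qed.

(** * Stage-wise approximation of the sum *)

(** The integer part of log2(c + 1), which is the length of the string with code [c], as a bounded
    sum. *)
Definition blen (c : nat) : nat := \sum_(0 <= i < c) (2 ^ i.+1 <= c.+1).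

(** The stage [t] bounds both the codes [d] of the programs tried and the search within each
    evaluation. *)
Definition compressed_by (e : rf) (t c : nat) : bool :=
  has (fun d => (stepf e t [:: d] == c.+1) && (blen d < blen c)) (iota 0 t).

(* Scaled by [D = (t + 1)^2], a lower approximation to the sum of
   [2^(- l * b / a)] over the lengths [l] of the strings found compressible
   within [t] steps: the inner sum is the integer part of [D * 2^(- l * b / a)]. *)
Definition Theta_approx (e : rf) (t a b : nat) : nat :=
  \sum_(0 <= c < t) compressed_by e t c *
    \sum_(0 <= i < t.+1 ^ 2)
      (i.+1 ^ a * 2 ^ (blen c * b) <= (t.+1 ^ 2) ^ a).

Lemma recursive_blen k F : recursive k F -> recursive k (fun v => blen (F v)).
Proof. by move=> rF; rewrite /blen; recursion. Qed.

Lemma recursive_stepf1 e k T F : recursive k T -> recursive k F ->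
  recursive k (fun v => stepf e (T v) [:: F v]).
Proof.
move=> rT rF; exact: (recursive_comp _ _ _ _ (recursive_stepf e 1)
  (recursives_cons _ _ _ _ rT
    (recursives_cons _ _ _ _ rF (recursives_nil k)))).
Qed.

Lemma recursive_compressed_by e k T F : recursive k T -> recursive k F ->
  recursive k (fun v => compressed_by e (T v) (F v)).
Proof.
move=> rT rF; apply: recursive_has_iota => //.
apply: (recursive_andb _ (fun w => stepf e (T (behead w)) [:: head 0 w] ==
  (F (behead w)).+1)); last by recursion; apply: recursive_blen; recursion.
recursion.
by apply: (recursive_stepf1 _ _ (fun w => T (behead w))); recursion.
Qed.

Lemma recursive_Theta_approx e k T A B :
  recursive k T -> recursive k A -> recursive k B ->
  recursive k (fun v => Theta_approx e (T v) (A v) (B v)).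
Proof.
move=> rT rA rB; rewrite /Theta_approx.
recursion; first by apply: recursive_compressed_by; recursion.
apply: (recursive_weaken _ (fun v => blen (head 0 v))).
by apply: recursive_blen; recursion.
Qed.

(** * The coding of binary strings *)

(** [bcode] is bijective binary notation with the least significant digit first; this is its
    successor with carry, and iterating it inverts [bcode]. *)
Fixpoint bsucc (s : seq bool) : seq bool :=
  match s with
  | [::] => [:: false]
  | false :: s' => true :: s'
  | true :: s' => false :: bsucc s'
  end.

Definition bdecode (n : nat) : seq bool := iter n bsucc [::].

Lemma bcode_bsucc s : bcode (bsucc s) = (bcode s).+1.
Proof. by elim: s => // -[] s /= IH; rewrite ?IH -!muln2; lia. Qed.

Lemma bdecodeK : cancel bdecode bcode.
Proof. by elim=> //= n IH; rewrite bcode_bsucc IH. Qed.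

Lemma bcode_inj : injective bcode.
Proof.
elim=> [|b s IH] [|c u] //=; rewrite ?addn1//.
move=> h; have [bc] : b = c /\ bcode s = bcode u.
  by move: h; rewrite -!muln2; case: b; case: c => /= h; split => //; lia.
by rewrite bc => /IH ->.
Qed.

Lemma bcodeK : cancel bcode bdecode.
Proof. by move=> s; apply: bcode_inj; rewrite bdecodeK. Qed.

Lemma bcode_bounds s : 2 ^ size s <= (bcode s).+1 < 2 ^ (size s).+1.
Proof.
elim: s => //= b s; rewrite !expnS -!muln2.
by case: b; rewrite /=; lia.
Qed.

Lemma sum_ltn n m : \sum_(0 <= i < n) (i < m) = minn n m.
Proof.
elim: n => [|n IH]; first by rewrite big_geq ?min0n.
by rewrite big_nat_recr//= IH; case: (ltnP n m) => /= h; lia.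
Qed.

(** By [bcode_bounds], the test in [blen] amounts to [i < size s]; as [size s <= bcode s], the range
    of the sum is long enough. *)
Lemma blen_bcode s : blen (bcode s) = size s.
Proof.
have /andP[lo hi] := bcode_bounds s; rewrite /blen.
have sc : size s <= bcode s.
  by rewrite -ltnS (leq_trans _ lo)// ltn_expl.
rewrite (eq_bigr (fun i => nat_of_bool (i < size s))) => [|i _].
  by rewrite sum_ltn; apply/minn_idPr.
congr nat_of_bool; apply/idP/idP => [ic|si].
  by rewrite -ltnS -(@ltn_exp2l 2)// (leq_ltn_trans ic).
by rewrite (leq_trans _ lo)// leq_exp2l.
Qed.

Lemma bdecode_size c : size (bdecode c) = blen c.
Proof. by rewrite -blen_bcode bdecodeK. Qed.

(** * Compressible strings and their enumeration *)

Definition compressible (V : seq bool -> option (seq bool)) (s : seq bool) :=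
  exists2 p, V p = Some s & size p < size s.

Section Compression.
Variables (V : seq bool -> option (seq bool)) (e : rf).
Hypothesis Ve : forall p s, V p = Some s <-> rf_eval e [:: bcode p] (bcode s).

Lemma compressed_by_sound t s : compressed_by e t (bcode s) -> compressible V s.
Proof.
move=> /hasP[d _ /andP[/eqP/stepf_sound]].
rewrite -(bdecodeK d) -Ve => Vd; rewrite !blen_bcode => ds.
by exists (bdecode d).
Qed.

Lemma compressed_by_mono t t' c : t <= t' -> compressed_by e t c ->
  compressed_by e t' c.
Proof.
move=> tt' /hasP[d]; rewrite mem_iota => /andP[_ dt] /andP[/eqP st dc].
apply/hasP; exists d; first by rewrite mem_iota (leq_trans dt).
by rewrite dc andbT (stepf_mono _ _ _ _ _ tt' st).
Qed.

Lemma compressed_by_complete s : compressible V s ->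
  exists t, compressed_by e t (bcode s).
Proof.
move=> [p /Ve /stepf_complete[t st] ps]; exists (maxn t (bcode p).+1).
apply/hasP; exists (bcode p); first by rewrite mem_iota; apply: leq_maxr.
by rewrite (stepf_mono _ _ _ _ _ (leq_maxl t _) st) eqxx !blen_bcode.
Qed.

End Compression.

(** * Existence of a compressible string *)

(** Its outputs 0^(2n) are about twice as long as its programs 0^n 1, so an optimal machine, which
    simulates it at constant cost, must compress some string. *)
Definition unary_doubler (p : seq bool) : option (seq bool) :=
  let n := (size p).-1 in
  if p == rcons (nseq n false) true then Some (nseq n.*2 false) else None.

Lemma unary_doublerE n :
  unary_doubler (rcons (nseq n false) true) = Some (nseq n.*2 false).
Proof. by rewrite /unary_doubler size_rcons size_nseq eqxx. Qed.

Lemma unary_doublerP p s : unary_doubler p = Some s ->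
  exists2 n, p = rcons (nseq n false) true & s = nseq n.*2 false.
Proof.
rewrite /unary_doubler; case: eqP => // pE [<-].
by exists (size p).-1.
Qed.

(** Together with [bcode_inj], this turns recognition of the program 0^n 1 into an arithmetic
    equation. *)
Lemma bcode_unary n : (bcode (rcons (nseq n false) true)).+1 = 3 * 2 ^ n.
Proof.
elim: n => [//|n IH]; rewrite expnS mulnCA -IH /= -muln2; lia.
Qed.

Lemma bcode_nseq_false n : bcode (nseq n false) = 2 ^ n - 1.
Proof.
elim: n => //= n ->; rewrite expnS -muln2; have := expn_gt0 2 n; lia.
Qed.

Lemma unary_doubler_prefix_free : prefix_free_machine unary_doubler.
Proof.
split.
  have [eo eoP] : recursive 1 (fun v => 2 ^ (head 0 v + head 0 v) - 1).
    by recursion.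
  (* [em] vanishes exactly when the second argument codes 0^n 1, so [rMu em] recovers [n] from a
     program and diverges on every other string. *)
  have [em emP] : recursive 2 (fun v =>
      ~~ ((head 0 (behead v)).+1 == 3 * 2 ^ head 0 v)) by recursion.
  have evm n c b : rf_eval em [:: n; c] b <-> b = ~~ (c.+1 == 3 * 2 ^ n).
    by split=> [/rf_eval_inj/(_ (emP [:: n; c] erefl))//|->]; apply: (emP [:: n; c]).
  exists (rComp eo [:: rMu em]) => p s; split.
    move=> /unary_doublerP[n -> ->].
    apply: (ev_comp (ys := [:: n])); last first.
      by rewrite bcode_nseq_false -addnn; apply: (eoP [:: n]).
    constructor; last by constructor.
    constructor; first by apply/evm; rewrite bcode_unary eqxx.
    move=> m mn; exists 0; apply/evm; rewrite bcode_unary eqn_pmul2l// eqn_exp2l//.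
    by rewrite gtn_eqF.
  move=> h.
  have [n [hn hs]] : exists n, rf_eval (rMu em) [:: bcode p] n /\
      rf_eval eo [:: n] (bcode s).
    inversion h as [| | |? ? ? ? ? H1 H2| | |]; subst.
    inversion H1 as [|? ? ? ? ? H3 H4]; subst; inversion H4; subst.
    by eexists; split; eassumption.
  have : rf_eval em [:: n; bcode p] 0 by inversion hn.
  move=> /evm /esym/eqP; rewrite eqb0 negbK -bcode_unary => /eqP[/bcode_inj ->].
  rewrite unary_doublerE; congr Some; apply: bcode_inj.
  rewrite bcode_nseq_false -addnn.
  exact: (rf_eval_inj _ _ _ _ (eoP [:: n] erefl) hs).
move=> p q; rewrite /dom.
case Ep: (unary_doubler p) => [s|//] _; case Eq: (unary_doubler q) => [u|//] _.
have [n pE _] := unary_doublerP _ _ Ep; have [m qE _] := unary_doublerP _ _ Eq.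
move=> /prefixP[w qpw].
suff nm : n = m by rewrite pE qE nm.
(* The first [true] is at position [n] in [p] and [m] in [q], and appending [w] to [p] does not move
   it. *)
have := congr1 (find id) qpw; rewrite pE qE -!cats1 -catA !find_cat.
have has_nseqF k : has id (nseq k false) = false by elim: k.
by rewrite !has_nseqF !size_nseq /= !addn0.
Qed.

Lemma optimal_compressible V : optimal V -> exists s, compressible V s.
Proof.
move=> [_ /(_ _ unary_doubler_prefix_free)[d dP]].
(* [unary_doubler] sends [n + 1] bits to [2 n], beating the overhead [d] once
   [n > d + 1]. *)
have [q [Vq qd]] := dP _ _ (unary_doublerE d.+2).
exists (nseq d.+2.*2 false), q => //.
rewrite size_nseq (leq_ltn_trans qd)// size_rcons size_nseq -muln2; lia.
Qed.

(** * Weights and their integer approximation *)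

Local Open Scope ring_scope.
Local Open Scope classical_set_scope.

Definition weight {R : realType} (r : R) (l : nat) : R :=
  powR 2 (- l%:R / r).

Lemma weight_gt0 (R : realType) (r : R) l : 0 < weight r l.
Proof. by rewrite powR_gt0. Qed.

Lemma ler_weight (R : realType) (r r' : R) l : 0 < r -> r <= r' ->
  weight r l <= weight r' l.
Proof.
move=> r0 rr'; apply: ler_powR; first by rewrite ler1n.
by rewrite !mulNr lerN2 ler_wpM2l// lef_pV2// posrE (lt_le_trans r0).
Qed.

Lemma ltr_weight (R : realType) (r r' : R) l : 0 < r -> r < r' -> (0 < l)%N ->
  weight r l < weight r' l.
Proof.
move=> r0 rr' l0; rewrite /weight /powR pnatr_eq0/= ltr_expR.
rewrite ltr_pM2r ?ln_gt0 ?ltr1n//.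
by rewrite !mulNr ltrN2 ltr_pM2l ?ltr0n// ltf_pV2// posrE (lt_trans r0).
Qed.

(* The sum is the integer part of [x]. *)
Lemma sum_ler_nat (R : realType) (x : R) (N : nat) : 0 <= x ->
  let k := (\sum_(0 <= i < N) (i.+1%:R <= x)%R)%N in
  k%:R <= x /\ (x <= N%:R -> x < k.+1%:R).
Proof.
move=> x0 k; have kE : k = minn N (Num.truncn x).
  by rewrite -sum_ltn; apply: eq_bigr => i _; rewrite truncn_ge_nat.
rewrite kE; split=> [|xN].
  by rewrite -truncn_ge_nat// geq_minr.
have [] := leqP N (Num.truncn x); last by move=> _; exact: truncnS_gt.
by move=> _; rewrite (le_lt_trans xN)// ltr_nat.
Qed.

(** Raising both sides to the power [a] removes the root from 2^(-l b / a) and leaves a comparison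
    of integers. *)
Lemma ler_nat_weight (R : realType) (D a b l i : nat) :
  (0 < a)%N -> (0 < b)%N ->
  (i ^ a * 2 ^ (l * b) <= D ^ a)%N =
  (i%:R <= D%:R * weight (a%:R / b%:R : R) l).
Proof.
move=> a0 b0; rewrite -(ler_pXn2r a0); first last.
- by rewrite nnegrE mulr_ge0// ltW// weight_gt0.
- by rewrite nnegrE.
have -> : (D%:R * weight (a%:R / b%:R : R) l) ^+ a =
    (D ^ a)%:R / (2 ^ (l * b))%:R.
  rewrite exprMn natrX; congr (_ * _).
  rewrite -powR_mulrn ?powR_ge0// -powRrM.
  have -> : - l%:R / (a%:R / b%:R) * a%:R = - (l * b)%:R :> R.
    by rewrite natrM; field; rewrite !pnatr_eq0 -!lt0n a0 b0.
  by rewrite powR_invn// natrX.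
by rewrite ler_pdivlMr ?ltr0n ?expn_gt0// -natrX -natrM ler_nat.
Qed.

(** Each of the [t] terms loses at most 1 in passing to its integer part. Relative to [D] the total
    error is at most t / (t + 1)^2, which tends to 0. *)
Lemma Theta_approx_bounds (R : realType) e t a b : (0 < a)%N -> (0 < b)%N ->
  let D : R := (t.+1 ^ 2)%:R in
  let S := \sum_(0 <= c < t)
    (compressed_by e t c)%:R * weight (a%:R / b%:R : R) (blen c) in
  (Theta_approx e t a b)%:R <= D * S /\ D * S <= (Theta_approx e t a b)%:R + t%:R.
Proof.
move=> a0 b0 D S.
pose k c := (\sum_(0 <= i < t.+1 ^ 2)
  (i.+1%:R <= D * weight (a%:R / b%:R : R) (blen c))%R)%N.
have AE : (Theta_approx e t a b)%:R =
    \sum_(0 <= c < t) (compressed_by e t c)%:R * (k c)%:R :> R.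
  rewrite /Theta_approx natr_sum; apply: eq_bigr => c _; rewrite natrM.
  congr (_ * _%:R); apply: eq_bigr => i _.
  by rewrite (ler_nat_weight R).
have x0 c : 0 <= D * weight (a%:R / b%:R : R) (blen c).
  by rewrite mulr_ge0// ltW// weight_gt0.
(* Weights are at most 1, so counting up to [D] yields the whole integer part. *)
have xD c : D * weight (a%:R / b%:R : R) (blen c) <= (t.+1 ^ 2)%:R.
  rewrite -[leRHS]mulr1 ler_wpM2l//.
  by rewrite -[leRHS](powRr0 2) ler_powR ?ler1n// mulNr oppr_le0.
rewrite AE mulr_sumr; split.
  apply: ler_sum => c _; rewrite mulrCA ler_wpM2l//.
  exact: (sum_ler_nat _ _ _ (x0 c)).1.
have -> : t%:R = \sum_(0 <= c < t) 1 :> R.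
  by rewrite sumr_const_nat subn0.
rewrite -big_split/=; apply: ler_sum => c _; rewrite mulrCA.
have := (sum_ler_nat _ _ _ (x0 c)).2 (xD c); rewrite -/(k c) -natr1 => /ltW.
by case: (compressed_by e t c) => /=; rewrite ?mul1r// !mul0r add0r.
Qed.

(** * The sum as a series over codes *)

Section Theta.
Context {R : realType}.
Variable V : seq bool -> option (seq bool).

Let chi c := `[< compressible V (bdecode c) >].

Lemma Hc_lt_size s : (@Hc R V s < (size s)%:R%:E)%E <-> compressible V s.
Proof.
split=> [/ereal_inf_lt[_ [p /= Vp <-]]|[p Vp ps]].
  by rewrite lte_fin ltr_nat => ps; exists p.
apply: (@le_lt_trans _ _ (size p)%:R%:E); last by rewrite lte_fin ltr_nat.
by apply: ereal_inf_lbound; exists p.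
Qed.

(** [bdecode] is a bijection from codes to strings, and nonnegative terms may be summed in the order
    of codes. *)
Lemma Theta_series (T : R) :
  (Theta V T = \sum_(c <oo | chi c) (weight T (blen c))%:E)%E.
Proof.
rewrite nneseries_esum; last by move=> n _; rewrite lee_fin ltW// weight_gt0.
rewrite /Theta (reindex_esum [set c | chi c] _ bdecode).
  by apply: eq_esum => c _; rewrite bdecode_size.
split=> [c /= /asboolP hc|c d _ _ cd|s /= hs].
- exact/Hc_lt_size.
- by rewrite -(bdecodeK c) cd bdecodeK.
- exists (bcode s); last exact: bcodeK.
  by apply/asboolP; rewrite bcodeK; apply/Hc_lt_size.
Qed.

Lemma partial_le_Theta (T theta : R) n : Theta V T = theta%:E ->
  \sum_(0 <= c < n | chi c) weight T (blen c) <= theta.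
Proof.
move=> h; rewrite -lee_fin -h Theta_series -sumEFin.
by apply: nneseries_lim_ge => c _; rewrite lee_fin ltW// weight_gt0.
Qed.

Lemma partial_gt_Theta (T theta eps : R) : Theta V T = theta%:E -> 0 < eps ->
  exists n, theta - eps < \sum_(0 <= c < n | chi c) weight T (blen c).
Proof.
move=> h e0; apply: contrapT => /forallNP hn.
suff : (Theta V T <= (theta - eps)%:E)%E.
  by rewrite h lee_fin lerBrDr gerDl leNgt e0.
rewrite Theta_series; apply: lime_le.
  by apply: is_cvg_nneseries_cond => c _ _; rewrite lee_fin ltW// weight_gt0.
apply: nearW => n; rewrite sumEFin lee_fin leNgt; apply/negP; exact: hn.
Qed.

End Theta.

(** * The test for a rational above [T] *)

(** With f = (fa - fb) / (fc + 1), this says that [Theta_approx] divided by (t + 1)^2 exceeds f t.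
    Denominators are cleared, and [fb] is moved to the right since subtraction on [nat]
    truncates. *)
Definition exceeds (e : rf) (fa fb fc : nat -> nat) (t a b : nat) : bool :=
  (fa t * t.+1 ^ 2 < Theta_approx e t a b * (fc t).+1 + fb t * t.+1 ^ 2)%N.

Section Exceeds.
Context {R : realType}.
Variables (V : seq bool -> option (seq bool)) (e : rf).
Hypothesis Ve : forall p s, V p = Some s <-> rf_eval e [:: bcode p] (bcode s).
Variables (fa fb fc : nat -> nat) (T theta : R).
Hypotheses (T0 : 0 < T) (Theta_T : Theta V T = theta%:E).

Let f t : R := ((fa t)%:R - (fb t)%:R) / (fc t).+1%:R.

Let chi c := `[< compressible V (bdecode c) >].

Lemma exceedsE t a b : exceeds e fa fb fc t a b =
  (f t * (t.+1 ^ 2)%:R < (Theta_approx e t a b)%:R).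
Proof.
rewrite /exceeds -(ltr_nat R) natrD !natrM /f mulrAC ltr_pdivrMr ?ltr0n//.
by rewrite mulrBl ltrBlDr.
Qed.

(** If a / b were at most [T], the scaled approximation would be at most a partial sum at [T], hence
    at most [theta] and [f t], and the test would fail. *)
Lemma exceeds_sound t a b : (0 < a)%N -> (0 < b)%N -> theta <= f t ->
  exceeds e fa fb fc t a b -> T < a%:R / b%:R.
Proof.
move=> a0 b0 ft; rewrite exceedsE ltNge => /negP h; rewrite ltNge.
apply/negP => abT; apply: h.
have [AS _] := Theta_approx_bounds R e t a b a0 b0.
apply: (le_trans AS); rewrite mulrC ler_wpM2r//.
apply: le_trans ft; apply: le_trans (partial_le_Theta V T theta t Theta_T).
rewrite [leRHS]big_mkcond; apply: ler_sum => c _.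
have [cc|_] := boolP (compressed_by e t c); last first.
  by rewrite mul0r; case: ifP => // _; apply/ltW/weight_gt0.
have -> : `[< compressible V (bdecode c) >].
  by apply/asboolP/(compressed_by_sound _ _ Ve t); rewrite bdecodeK.
by rewrite mul1r ler_weight// divr_gt0// ltr0n.
Qed.

(** Finitely many codes are involved; each compressible one is found at some stage and, by
    [compressed_by_mono], at all later ones. *)
Lemma near_compressed_by n :
  \forall t \near \oo, forall c, (c < n)%N -> chi c -> compressed_by e t c.
Proof.
elim: n => [|n IH]; first exact: nearW.
have [/asboolP/(compressed_by_complete _ _ Ve)[u]|hn] := boolP (chi n).
  rewrite bdecodeK => un; near=> t => c; rewrite ltnS leq_eqVlt.
  move=> /predU1P[-> _|cn].
    by apply: compressed_by_mono un; near: t; exact: nbhs_infty_ge.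
  by move: c cn; near: t.
near=> t => c; rewrite ltnS leq_eqVlt => /predU1P[->|cn].
  by rewrite (negbTE hn).
by move: c cn; near: t.
Unshelve. all: by end_near. Qed.

(** The stage does not depend on [a] and [b]: the estimates are made with the weights at [r] and
    pass to every a / b >= r by monotonicity. *)
Lemma exceeds_complete (r : R) : (exists s, compressible V s) ->
  f @ \oo --> theta -> T < r ->
  \forall t \near \oo, forall a b, (0 < a)%N -> (0 < b)%N ->
    r <= a%:R / b%:R -> exceeds e fa fb fc t a b.
Proof.
move=> [s hs] ftheta Tr.
have s0 : (0 < size s)%N by case: hs => p _; apply: leq_ltn_trans.
(* The term of [s] gains 4 d between [T] and [r]. One d pays for cutting off the series, one for the
   distance from [f t] to [theta], one for the rounding; one is spare. *)
pose d := (weight r (size s) - weight T (size s)) / 4.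
have d0 : 0 < d by rewrite divr_gt0// subr_gt0 ltr_weight.
have [n un] := partial_gt_Theta V T theta d Theta_T d0.
pose m := maxn n (bcode s).+1.
have um : theta + 3 * d < \sum_(0 <= c < m | chi c) weight r (blen c).
  have sm : bcode s \in index_iota 0 m by rewrite mem_index_iota; apply: leq_maxr.
  have chis : chi (bcode s) by apply/asboolP; rewrite bcodeK.
  have le1 : \sum_(0 <= c < n | chi c) weight T (blen c) <=
      \sum_(0 <= c < m | chi c) weight T (blen c).
    rewrite [leRHS](@big_cat_nat _ _ _ n)//=; last exact: leq_maxl.
    rewrite lerDl.
    by apply: sumr_ge0 => c _; apply/ltW/weight_gt0.
  suff : \sum_(0 <= c < m | chi c) weight T (blen c) + 4 * d <=
      \sum_(0 <= c < m | chi c) weight r (blen c) by lra.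
  (* The term of [s] is split off; it yields the gain, and no other term decreases. *)
  rewrite (big_rem _ sm)/= [leRHS](big_rem _ sm)/= chis blen_bcode.
  set rm := rem _ _.
  have : \sum_(c <- rm | chi c) weight T (blen c) <=
      \sum_(c <- rm | chi c) weight r (blen c).
    by apply: ler_sum => c _; rewrite ler_weight// ltW.
  by rewrite /d; lra.
near=> t => a b a0 b0 rab.
rewrite exceedsE.
have [_ AS] := Theta_approx_bounds R e t a b a0 b0.
have mt : (m <= t)%N by near: t; exact: nbhs_infty_ge.
have mS : \sum_(0 <= c < m | chi c) weight r (blen c) <=
    \sum_(0 <= c < t)
      (compressed_by e t c)%:R * weight (a%:R / b%:R) (blen c).
  rewrite [leRHS](@big_cat_nat _ _ _ m)//=.
  rewrite big_mkcond/= -[leLHS]addr0 lerD//; last first.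
    by apply: sumr_ge0 => c _; rewrite mulr_ge0// ltW// weight_gt0.
  apply: ler_sum_nat => c /andP[_ cm]; case: ifPn => chic; last first.
    by rewrite mulr_ge0// ltW// weight_gt0.
  suff -> : compressed_by e t c by rewrite mul1r ler_weight// (lt_trans T0).
  by move: c cm chic; near: t; exact: near_compressed_by.
have ft : f t < theta + d.
  by near: t; apply: (cvgr_lt theta) => //; rewrite ltrDl.
have td : t%:R < d * (t.+1 ^ 2)%:R.
  have tinv : t.+1%:R^-1 < d.
    by near: t; apply: (near_infty_natSinv_lt (PosNum d0)).
  have : 1 < d * t.+1%:R.
    by rewrite -ltr_pdivrMr ?ltr0n// div1r.
  move=> d1; rewrite expnS expn1 natrM mulrA.
  apply: (@le_lt_trans _ _ t.+1%:R); first by rewrite ler_nat.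
  by rewrite -[ltLHS]mul1r ltr_pM2r ?ltr0n.
have D0 : 0 < (t.+1 ^ 2)%:R :> R by rewrite ltr0n expn_gt0.
rewrite -[ltRHS](addrK t%:R) ltrBrDr; apply: lt_le_trans AS.
rewrite [ltRHS]mulrC.
apply: (@lt_le_trans _ _ ((theta + 3 * d) * (t.+1 ^ 2)%:R)).
  nra.
by rewrite ler_wpM2r// ltW// (lt_le_trans um).
Unshelve. all: by end_near. Qed.

End Exceeds.

(** * The upper approximation of [T] *)

(** The outer successor compensates for the integer part: the failures include all multiples of 1 /
    (n + 1) up to [T], and one more multiple lies above [T]. The stage [n.+1] is positive, where the
    given rationals bound the sum from above. *)
Definition upper_num (e : rf) (fa fb fc : nat -> nat) (n : nat) : nat :=
  (\sum_(0 <= i < n.+1) ~~ exceeds e fa fb fc n.+1 i.+1 n.+1).+1.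

Lemma total_recursive_upper_num e fa fb fc :
  total_recursive fa -> total_recursive fb -> total_recursive fc ->
  total_recursive (upper_num e fa fb fc).
Proof.
move=> ra rb rc; apply: total_recursive_recursive; rewrite /upper_num /exceeds.
recursion; try (by apply: recursive_total_recursive => //; recursion).
by apply: recursive_Theta_approx; recursion.
Qed.

Theorem theorem11 (R : realType) (V : seq bool -> option (seq bool))
  (hV : optimal V) (T : R) (hT0 : 0 < T) (hT1 : T < 1) :
  (exists theta : R, Theta V T = theta%:E /\ right_computable theta) ->
  right_computable T.
Proof.
move=> [th [hth [g [hg g_ge g_cvg]]]].
have [fa [fb [fc [ra rb rc gE]]]] := hg.
have [[[e Ve] _] _] := hV.
pose f t : R := ((fa t)%:R - (fb t)%:R) / (fc t).+1%:R.
have gf t : (0 < t)%N -> ratr (g t) = f t.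
  by move=> /gE ->; rewrite fmorph_div rmorphB !rmorph_nat.
have f_cvg : f @ \oo --> th.
  apply: cvg_trans g_cvg; apply: near_eq_cvg; near=> t; rewrite gf//.
  by near: t; exact: nbhs_infty_gt.
pose N := upper_num e fa fb fc.
pose h n : rat := ((N n)%:Q - 0%:Q) / n.+1%:Q.
have hE n : ratr (h n) = (N n)%:R / n.+1%:R :> R.
  by rewrite /h subr0 fmorph_div !rmorph_nat.
have h_ge n : T <= ratr (h n).
  rewrite hE ler_pdivlMr ?ltr0n//.
  have Tn0 : 0 <= T * n.+1%:R by rewrite mulr_ge0// ltW.
  (* As [T < 1], the [n.+1] multiples tested suffice to count the integer part of T (n + 1). *)
  have [_ /(_ _)/ltW/le_trans] := sum_ler_nat _ _ n.+1 Tn0; apply.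
    by rewrite -[leRHS]mul1r ler_wpM2r// ltW.
  rewrite ler_nat ltnS; apply: leq_sum => i _.
  have [hi|_] := boolP (exceeds e fa fb fc n.+1 i.+1 n.+1); last exact: leq_b1.
  have := exceeds_sound V e Ve fa fb fc T th hth n.+1 i.+1 n.+1.
  rewrite -/(f n.+1) -gf// => /(_ isT isT (g_ge n.+1 isT) hi).
  by rewrite ltr_pdivlMr ?ltr0n// ltNge => /negbTE ->.
exists h; split; [|by move=> n _; exact: h_ge|].
  exists N, (fun=> 0%N), id; split => //.
  - exact: total_recursive_upper_num.
  - by apply: total_recursive_recursive; recursion.
  - by apply: total_recursive_recursive; recursion.
apply/cvgrPdist_le => eps eps0.
(* Half of [eps] covers failures of multiples between [T] and [r], the other half the extra 1 / (n +
   1) from the successor in [upper_num]. *)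
pose r := T + eps / 2.
have Tr : T < r by rewrite ltrDl divr_gt0.
have [n0 _ exc] := exceeds_complete V e Ve fa fb fc T th hT0 hth r
  (optimal_compressible _ hV) f_cvg Tr.
near=> n.
rewrite distrC ger0_norm ?subr_ge0// lerBlDl hE ler_pdivrMr ?ltr0n//.
have rn0 : 0 <= r * n.+1%:R by rewrite mulr_ge0// ltW// (lt_trans hT0).
have [kr _] := sum_ler_nat _ _ n.+1 rn0.
have Nk : (N n)%:R <= r * n.+1%:R + 1.
  rewrite /N /upper_num -natr1 lerD2r; apply: le_trans kr; rewrite ler_nat.
  apply: leq_sum => i _.
  (* At large stages every multiple above [r] passes the test, so at most r (n + 1) of them fail. *)
  have [_|ri] := leP i.+1%:R (r * n.+1%:R); first exact: leq_b1.
  rewrite exc//; last first.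
    by rewrite ler_pdivlMr ?ltr0n// ltW.
  by rewrite /= (@leq_trans n)//; near: n; exact: nbhs_infty_ge.
have : n.+1%:R^-1 < eps / 2.
  by near: n; apply: (near_infty_natSinv_lt (PosNum (divr_gt0 eps0 _))).
rewrite -[X in X < _]div1r ltr_pdivrMr ?ltr0n// => ne.
by apply: (le_trans Nk); rewrite /r; lra.
Unshelve. all: by end_near. Qed.
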